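(* For every $k\in\mathbb{N}$: $$\tau_{k+2,k}=\frac{1}{2k+1},\qquad \tau_{k+3,k}=\frac{1}{2k+1}\Big(\frac{2}{k+2}\Big)^{1/2},\qquad \tau_{k+4,k}=\frac{1}{2k+1}\,\frac{3}{k+3},$$ and consequently $\tau_{n,k}\le \frac{1}{2k+1}$ for $n\ge k+2$, $\tau_{n,k}\le \frac{1}{2k+1}\big(\frac{2}{k+2}\big)^{1/2}$ for $n\ge k+3$, and $\tau_{n,k}\le\frac{1}{2k+1}\frac{3}{k+3}$ for $n\ge k+4$.
   Context: $T_n$ denotes the Chebyshev polynomial of the first kind of degree $n$, $T_n(\cos\theta)=\cos n\theta$. For integers $n\ge k+2$, $k\ge 1$, let $\omega_{n,k}$ be the rightmost (largest) zero of $T_n^{(k+1)}$ and define $\tau_{n,k}:=|T_n^{(k)}(\omega_{n,k})|/T_n^{(k)}(1)$. *)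

(* Defs.v *)
From HB Require Import structures.
From mathcomp Require Import all_boot all_order all_algebra.
From mathcomp Require Import reals.
Set Implicit Arguments. Unset Strict Implicit. Unset Printing Implicit Defensive.
Import Order.TTheory GRing.Theory Num.Theory.
Local Open Scope ring_scope.

Section Cheb.
Variable R : realType.

Fixpoint cheb_pair (n : nat) : {poly R} * {poly R} :=
  match n with
  | 0 => (1, 'X)
  | n'.+1 => let: (a, b) := cheb_pair n' in (b, 2%:P * 'X * b - a)
  end.

(* Chebyshev polynomial of the first kind, T_n(cos t) = cos (n t) *)
Definition cheb (n : nat) : {poly R} := (cheb_pair n).1.

Definition rightmost_root (p : {poly R}) (w : R) : Prop :=
  root p w /\ (forall x : R, root p x -> x <= w).

Definition tau_at (n k : nat) (w : R) : R :=
  `|((cheb n)^`(k)).[w]| / ((cheb n)^`(k)).[1].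

Definition tau_eq (n k : nat) (v : R) : Prop :=
  exists2 w : R, rightmost_root ((cheb n)^`(k.+1)) w & tau_at n k w = v.

Definition tau_le (n k : nat) (v : R) : Prop :=
  forall w : R, rightmost_root ((cheb n)^`(k.+1)) w -> tau_at n k w <= v.
End Cheb.

(* Main.v *)
(** Write C_m for the j-th derivative of U_(m+j), a multiple of the Gegenbauer
polynomial of degree m and parameter j + 1 = k; then T_(m+k)^(k) = (m+k) C_m.
With A = C_m' and B = C_(m+1)', the two relations
  x B - A = (m+1) C_(m+1)   and   B - x A = (m+2k) C_m
give (A^2 - 2xAB + B^2)' = 4k A B.  If w_m denotes the largest zero of C_m',
then w_m < w_(m+1), and A > 0 > B in between, so A^2 - 2xAB + B^2 decreases on
[w_m, w_(m+1)].  By the same relations its values at the two ends are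
((m+2k) C_m(w_m))^2 and ((m+1) C_(m+1)(w_(m+1)))^2; as
(m+1) C_(m+1)(1) = (m+2k) C_m(1), this says that tau_(n,k) decreases with n.
The values for n = k+2, k+3, k+4 are computed from the explicit C_2, C_3, C_4. *)

Require Import Defs.
From HB Require Import structures.
From mathcomp Require Import all_boot all_order all_algebra.
From mathcomp Require Import reals.
From mathcomp Require Import polyrcf.
From mathcomp Require Import ring zify.
Import Order.TTheory GRing.Theory Num.Theory.
Local Open Scope ring_scope.

Section Gegenbauer.
Local Set Implicit Arguments.
Local Unset Strict Implicit.
Variable R : realType.
Implicit Types (j m n : nat) (x y w : R).

(** * Chebyshev polynomials of the second kind *)

Fixpoint chebU (n : nat) : {poly R} :=
  if n is n1.+1 then
    if n1 is n2.+1 then 2%:R * 'X * chebU n1 - chebU n2 else 2%:R * 'X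
  else 1.

Lemma chebUSS n : chebU n.+2 = 2%:R * 'X * chebU n.+1 - chebU n.
Proof. by []. Qed.

Lemma deriv_natM n (p : {poly R}) : (n%:R * p)^`() = n%:R * p^`().
Proof. by rewrite !mulr_natl derivMn. Qed.

(** The relations are proved jointly: in the inductive step the first eliminates the derivative of
    the lower polynomial, and the second then expresses that polynomial through [u] and [du]. *)
Lemma deriv_chebU n :
  'X * (chebU n.+1)^`() - (chebU n)^`() = n.+1%:R * chebU n.+1 /\
  (chebU n.+1)^`() - 'X * (chebU n)^`() = n.+2%:R * chebU n.
Proof.
elim: n => [|n [IH1 IH2]].
  rewrite /= deriv_natM derivX -polyC1 derivC polyC1; split; ring.
move: IH1 IH2; rewrite chebUSS derivB -mulrA deriv_natM derivM derivX mul1r.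
move: (chebU n.+1) (chebU n) => u v.
move: (u^`()) (v^`()) => du dv IH1 IH2.
have Ev : dv = 'X * du - n.+1%:R * u by rewrite -IH1; ring.
have Ew2 : n.+2%:R * v = du - 'X * ('X * du - n.+1%:R * u) by rewrite -Ev IH2.
split.
  apply/subr0_eq.
  transitivity ((n.+2%:R * v) - (du - 'X * ('X * du - n.+1%:R * u))).
    rewrite Ev. ring.
  rewrite Ew2 subrr //.
rewrite Ev; ring.
Qed.

(** * Gegenbauer polynomials as derivatives of [chebU] *)

Definition geg (j m : nat) : {poly R} := (chebU (m + j))^`(j).

Lemma deriv_geg j m : (geg j m.+1)^`() = geg j.+1 m.
Proof. by rewrite /geg -derivnS addSnnS. Qed.

Lemma derivn_XM n (p : {poly R}) :
  ('X * p)^`(n.+1) = 'X * p^`(n.+1) + n.+1%:R * p^`(n).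
Proof.
have := derivnMXaddC n p 0.
by rewrite polyC0 addr0 mulrC => ->; rewrite -mulr_natl; ring.
Qed.

Lemma derivn_natM a n (p : {poly R}) : (a%:R * p)^`(n) = a%:R * p^`(n).
Proof. by rewrite !mulr_natl derivnMn. Qed.

Lemma horner_natM a x (p : {poly R}) : (a%:R * p).[x] = a%:R * p.[x].
Proof. by rewrite !mulr_natl hornerMn. Qed.

(** Differentiate the first relation for [chebU] [j] times: the Leibniz term lowers the factor from
    m+j+1 to m+1. *)
Lemma geg_rel1 j m :
  'X * (geg j m.+1)^`() - (geg j m)^`() = m.+1%:R * geg j m.+1.
Proof.
have [/(congr1 (derivn j)) H _] := deriv_chebU (m + j).
move: H; rewrite derivnB derivn_natM /geg addSn -!derivnS !derivSn.
case: j => [|j]; first by rewrite !derivn0 addn0.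
rewrite derivn_XM -!derivSn => H; apply/subr0_eq.
move/eqP: H; rewrite -subr_eq0 => /eqP <-.
move: (_^`(j.+1)) (_^`(j.+2)) (_^`(j.+2)) => a b c; ring.
Qed.

(** Here the Leibniz term comes from the lower polynomial and raises the factor from m+j+2 to
    m+2j+2. *)
Lemma geg_rel2 j m :
  (geg j m.+1)^`() - 'X * (geg j m)^`() = (m + j.*2.+2)%:R * geg j m.
Proof.
have [_ /(congr1 (derivn j)) H] := deriv_chebU (m + j).
move: H; rewrite derivnB derivn_natM /geg addSn -!derivnS !derivSn.
case: j => [|j]; first by rewrite !derivn0 addn0 addn2.
rewrite derivn_XM -!derivSn => H; apply/subr0_eq.
move/eqP: H; rewrite -subr_eq0 => /eqP <-; rewrite -muln2.
move: (_^`(j.+1)) (_^`(j.+2)) (_^`(j.+2)) => a b c; ring.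
Qed.

(** The two relations turn the outer terms into derivatives; their other instances, with
    [geg j m.+1] on the right, eliminate the outer derivatives. *)
Lemma geg_rec j m : m.+2%:R * geg j m.+2 =
  (2 * (m + j).+2)%:R * 'X * geg j m.+1 - (m + j.*2.+2)%:R * geg j m.
Proof.
have E1 := geg_rel1 j m; have E2 := geg_rel2 j m.+1.
rewrite -geg_rel1 -[X in _ = _ - X]geg_rel2; move: E1 E2; rewrite -muln2.
move: (geg j m.+1) (geg j m.+1)^`() (geg j m)^`() (geg j m.+2)^`() => u b a c E1 E2.
have -> : c = 'X * b + (m.+1 + (j * 2).+2)%:R * u by rewrite -E2; ring.
have -> : a = 'X * b - m.+1%:R * u by rewrite -E1; ring.
ring.
Qed.

Lemma geg0_const j : exists2 c : R, 0 < c & geg j 0 = c%:P.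
Proof.
elim: j => [|j [c c0 Ec]]; first by exists 1.
exists ((j.*2.+2)%:R * c); first by rewrite mulr_gt0 ?ltr0n.
have := geg_rel2 j 0.
by rewrite deriv_geg Ec derivC mulr0 subr0 add0n polyCM polyC_natr => ->.
Qed.

Lemma geg_1 j : geg j 1 = j.*2.+2%:R * 'X * geg j 0.
Proof.
have [c _ Ec] := geg0_const j.
have := geg_rel1 j 0; have := geg_rel2 j 0.
by rewrite Ec derivC mulr0 !subr0 mul1r add0n => -> <-; rewrite mulrCA mulrA.
Qed.

Lemma horner_geg1 j x : (geg j 1).[x] = j.*2.+2%:R * x * (geg j 0).[x].
Proof. by rewrite geg_1 -mulrA horner_natM hornerM hornerX mulrA. Qed.

Lemma horner_geg_rec j m x : m.+2%:R * (geg j m.+2).[x] =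
  (2 * (m + j).+2)%:R * x * (geg j m.+1).[x]
  - (m + j.*2.+2)%:R * (geg j m).[x].
Proof.
have := congr1 (horner^~ x) (geg_rec j m).
by rewrite hornerD hornerN -mulrA !horner_natM hornerM hornerX mulrA.
Qed.

(** At 1 the left sides of [geg_rel1] and [geg_rel2] coincide. *)
Lemma geg_at1 j m :
  m.+1%:R * (geg j m.+1).[1] = (m + j.*2.+2)%:R * (geg j m).[1].
Proof.
have := congr1 (horner^~ 1) (geg_rel1 j m).
have := congr1 (horner^~ 1) (geg_rel2 j m).
by rewrite !hornerD !hornerN !horner_natM !hornerM !hornerX !mul1r => -> ->.
Qed.

(** * Positivity and largest zeros *)

Lemma geg_at1_gt0 j m : 0 < (geg j m).[1].
Proof.
elim: m => [|m IH]; first by have [c c0 ->] := geg0_const j; rewrite hornerC.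
by rewrite -(pmulr_rgt0 _ (ltr0Sn R m)) geg_at1 mulr_gt0 // ltr0n addnS.
Qed.

(* A Christoffel-Darboux kernel without division by [x - y]: to the right of the
   largest zeros of lower degree, [geg j m.+1 / geg j m] is increasing. *)
Lemma geg_cross_gt0 j m x y : y < x ->
  (forall i, (i <= m)%N -> 0 < (geg j i).[x] /\ 0 < (geg j i).[y]) ->
  0 < (geg j m.+1).[x] * (geg j m).[y] - (geg j m).[x] * (geg j m.+1).[y].
Proof.
move=> yx; elim: m => [|m IH] pos.
  have [c c0 Ec] := geg0_const j; rewrite !horner_geg1 Ec !hornerC.
  have -> : j.*2.+2%:R * x * c * c - c * (j.*2.+2%:R * y * c) =
    j.*2.+2%:R * (c * c) * (x - y) by ring.
  by rewrite !mulr_gt0 ?ltr0n ?subr_gt0.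
have {}IH := IH (fun i im => pos i (leqW im)).
have [px py] := pos m.+1 (leqnn _).
rewrite -(pmulr_rgt0 _ (ltr0Sn R m.+1)).
rewrite [X in 0 < X](_ : _ = (m.+2%:R * (geg j m.+2).[x]) * (geg j m.+1).[y]
  - (geg j m.+1).[x] * (m.+2%:R * (geg j m.+2).[y])); last by ring.
(* The recurrence splits the cross difference into a positive multiple of x - y and a positive
   multiple of the preceding cross difference. *)
rewrite !horner_geg_rec [X in 0 < X](_ : _ =
  (2 * (m + j).+2)%:R * (x - y) * ((geg j m.+1).[x] * (geg j m.+1).[y])
  + (m + j.*2.+2)%:R *
    ((geg j m.+1).[x] * (geg j m).[y] - (geg j m).[x] * (geg j m.+1).[y]));
  last by ring.
by apply: addr_gt0; rewrite !mulr_gt0 ?ltr0n ?addnS // subr_gt0.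
Qed.

(* The positivity of all lower degrees at and beyond [w] is what makes the
   induction on [m] go through; it also forces [w] to be the largest zero. *)
Definition toproot (j m : nat) (w : R) : Prop :=
  [/\ w < 1, (geg j m.+1).[w] = 0, forall i, (i <= m)%N -> 0 < (geg j i).[w]
   & forall x, w < x -> forall i, (i <= m.+1)%N -> 0 < (geg j i).[x]].

Lemma toproot_rightmost j m w : toproot j m w -> rightmost_root (geg j m.+1) w.
Proof.
case=> _ w0 _ pos; split; first exact/rootP.
by move=> x /rootP x0; rewrite leNgt; apply/negP => /pos/(_ m.+1 (leqnn _));
  rewrite x0 ltxx.
Qed.

Lemma rightmost_root_inj (p : {poly R}) w w' :
  rightmost_root p w -> rightmost_root p w' -> w = w'.
Proof.
by move=> [r h] [r' h']; apply/eqP; rewrite eq_le h' // h.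
Qed.

Lemma toproot0 j : toproot j 0 0.
Proof.
have [c c0 Ec] := geg0_const j.
split=> //.
- by rewrite horner_geg1 mulr0 mul0r.
- by move=> [|//] _; rewrite Ec hornerC.
- move=> x x0 [|[|//]] _; rewrite ?horner_geg1 Ec hornerC //.
  by rewrite !mulr_gt0 ?ltr0n.
Qed.

(** At [w] the middle term of the recurrence vanishes, so [geg j m.+2] is negative there, and it is
    positive at 1. Whichever zero the intermediate value theorem returns, [geg_cross_gt0] fixes the
    sign on both sides of it. *)
Lemma toprootS j m w : toproot j m w ->
  exists w', [/\ toproot j m.+1 w', w < w' &
    forall y, w < y -> y < w' -> (geg j m.+2).[y] < 0].
Proof.
move=> [w1 w0 posw pos].
have neg : (geg j m.+2).[w] < 0.
  rewrite -(pmulr_rlt0 _ (ltr0Sn R m.+1)) horner_geg_rec w0 mulr0 sub0r oppr_lt0.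
  by rewrite mulr_gt0 ?posw // ltr0n addnS.
have [w' /andP[ww' w'1] /rootP rw'] : exists2 w', w <= w' <= 1 & root (geg j m.+2) w'.
  apply: poly_ivt; first exact: ltW.
  by rewrite (ltW neg) ltW ?geg_at1_gt0.
have {}ww' : w < w'.
  by rewrite lt_neqAle ww' andbT; apply: contraTneq neg => ->; rewrite rw' ltxx.
have {}w'1 : w' < 1.
  rewrite lt_neqAle w'1 andbT; apply/eqP => e.
  by have := geg_at1_gt0 j m.+2; rewrite -e rw' ltxx.
exists w'; split=> //.
- split=> //; first exact: pos.
  move=> x w'x i; rewrite leq_eqVlt => /orP[/eqP ->|]; last exact: pos (lt_trans ww' w'x) _.
  (* With [w'] as one of the points, only one product of the cross difference survives. *)
  have := @geg_cross_gt0 j m.+1 x w' w'x.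
  rewrite rw' mulr0 subr0 => H.
  rewrite -(pmulr_lgt0 _ (pos w' ww' m.+1 (leqnn _))); apply: H => l lm.
  by split; apply: pos => //; apply: lt_trans w'x.
- move=> y wy yw'.
  have := @geg_cross_gt0 j m.+1 w' y yw'.
  rewrite rw' mul0r sub0r oppr_gt0 => H.
  rewrite -(pmulr_rlt0 _ (pos w' ww' m.+1 (leqnn _))); apply: H => l lm.
  by split; apply: pos.
Qed.

Lemma toproot_ex j m : exists w, toproot j m w.
Proof.
elim: m => [|m [w /toprootS[w' [h _ _]]]]; last by exists w'.
by exists 0; apply: toproot0.
Qed.

(** * The energy and its monotonicity *)

(** Differentiating the two relations gives A' - xB' = -mB and B' - xA' = (m+2j+3)A, so [m] cancels
    in 2A(A' - xB') + 2B(B' - xA') - 2AB. *)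
Lemma deriv_energy j m :
  let A := (geg j m)^`() in let B := (geg j m.+1)^`() in
  (A ^+ 2 - 2%:R * 'X * A * B + B ^+ 2)^`() = (4 * j.+1)%:R * (A * B).
Proof.
move=> A B.
have E1 := congr1 deriv (geg_rel1 j m); have E2 := congr1 deriv (geg_rel2 j m).
move: E1 E2; rewrite -/A -/B !derivB !deriv_natM !derivM derivX !mul1r -/A -/B => E1 E2.
rewrite derivD derivB !expr2 -!mulrA deriv_natM !derivM !derivX.
move: E1 E2; rewrite -muln2; move: (A^`()) (B^`()) => dA dB E1 E2.
have F1 : dA - 'X * dB = B - m.+1%:R * B by rewrite -E1; ring.
have F2 : dB - 'X * dA = (m + (j * 2).+2)%:R * A + A by rewrite -E2; ring.
transitivity (2%:R * A * (dA - 'X * dB) + 2%:R * B * (dB - 'X * dA)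
  - 2%:R * A * B); first by ring.
by rewrite F1 F2; ring.
Qed.

Definition rel_value j m w : R := `|(geg j m).[w]| / (geg j m).[1].

Lemma rel_value_le j m w w' : toproot j.+1 m w -> toproot j.+1 m.+1 w' ->
  rel_value j m.+3 w' <= rel_value j m.+2 w.
Proof.
move=> tw tw'.
(* [toprootS] yields its own zero [w'']; uniqueness of the largest zero identifies it with [w']. *)
have [w'' [tw'' ww' neg]] := toprootS tw.
move: ww' neg; rewrite (rightmost_root_inj (toproot_rightmost tw'')
  (toproot_rightmost tw')) => ww' neg.
have [_ w0 _ pos] := tw; have [_ w'0 _ _] := tw'.
have := deriv_energy j m.+2; cbv zeta; rewrite !deriv_geg.
set E := (X in X^`() = _) => dE.
have Ev x : E.[x] = (geg j.+1 m.+1).[x] ^+ 2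
   - 2%:R * x * (geg j.+1 m.+1).[x] * (geg j.+1 m.+2).[x]
   + (geg j.+1 m.+2).[x] ^+ 2.
  by rewrite /E !expr2 hornerD hornerD hornerN -!mulrA horner_natM !hornerM hornerX.
have : E.[w'] <= E.[w].
  (* On [w, w'] the product AB is nonpositive, so [- E] is nondecreasing. *)
  have := @ler_hornerW _ w w' (- E).
  rewrite derivN dE => /(_ _ w w'); rewrite !hornerN lerN2; apply.
  - move=> x; rewrite in_itv /= => /andP[wx xw'].
    rewrite hornerN horner_natM hornerM oppr_ge0 pmulr_rle0 ?ltr0n //.
    by rewrite pmulr_rle0 ?pos // ltW ?neg.
  - by rewrite in_itv /= lexx ltW.
  - by rewrite in_itv /= lexx ltW.
  - exact: ltW.
(* A vanishes at [w] and B at [w'], so the energy is a single square at each end. *)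
rewrite !Ev w0 w'0 expr0n /= !(mulr0, mul0r, subr0, addr0, oppr0, add0r).
have := congr1 (horner^~ w) (geg_rel2 j m.+2).
have := congr1 (horner^~ w') (geg_rel1 j m.+2).
rewrite /= !deriv_geg !hornerD !hornerN !horner_natM !hornerM !hornerX w0 w'0.
rewrite !mulr0 sub0r subr0 => e1 e2.
rewrite e2 -sqrrN e1 => H2.
have {H2} : `|m.+3%:R * (geg j m.+3).[w']| <=
    `|(m.+2 + j.*2.+2)%:R * (geg j m.+2).[w]|.
  by rewrite -ler_sqr ?nnegrE // !real_normK ?num_real.
rewrite !normrM !normr_nat => H.
rewrite /rel_value.
have c1 := geg_at1_gt0 j m.+2; have c2 := geg_at1_gt0 j m.+3.
(* After clearing denominators, [geg_at1] matches the weights m+3 and m+2j+4 with the values at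
   1. *)
rewrite ler_pdivrMr // mulrAC ler_pdivlMr //.
rewrite -(ler_pM2l (ltr0Sn R m.+2)) mulrA (le_trans (ler_wpM2r (ltW c1) H)) //.
by rewrite [leRHS]mulrCA geg_at1 mulrCA mulrA.
Qed.

Lemma rel_value_le_from j m0 m w w0 : (m0 <= m)%N ->
  toproot j.+1 m0 w0 -> toproot j.+1 m w ->
  rel_value j m.+2 w <= rel_value j m0.+2 w0.
Proof.
move=> le0m t0; elim: m le0m w => [|m IH].
  rewrite leqn0 => /eqP m00 w tw; rewrite m00 in t0 *.
  by rewrite (rightmost_root_inj (toproot_rightmost t0) (toproot_rightmost tw)).
rewrite leq_eqVlt => /orP[/eqP e w tw|lt0m w tw].
  rewrite e in t0 *.
  by rewrite (rightmost_root_inj (toproot_rightmost t0) (toproot_rightmost tw)).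
have [v tv] := toproot_ex j.+1 m.
exact: le_trans (rel_value_le tv tw) (IH lt0m _ tv).
Qed.

(** * Transfer to the polynomials [cheb] *)

Lemma chebSS n : cheb R n.+2 = 2%:R * 'X * cheb R n.+1 - cheb R n.
Proof. by rewrite -(polyC_natr R 2) /cheb /=; case: (cheb_pair R n). Qed.

(** Two consecutive indices are carried because the recurrence has order two. *)
Lemma cheb_chebU n : cheb R n.+1 = chebU n.+1 - 'X * chebU n /\
  cheb R n.+2 = chebU n.+2 - 'X * chebU n.+1.
Proof.
elim: n => [|n [IH1 IH2]].
  by rewrite chebSS /cheb /=; split; ring.
split=> //; rewrite chebSS IH1 IH2 !chebUSS.
by move: (chebU _) (chebU _) => a b; ring.
Qed.

(** Differentiating U_(n+1) - x U_n leaves the second relation of [deriv_chebU] minus U_n. *)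
Lemma deriv_cheb n : (cheb R n.+1)^`() = n.+1%:R * chebU n.
Proof.
have [_ E] := deriv_chebU n; have [-> _] := cheb_chebU n.
rewrite derivB derivM derivX mul1r opprD addrCA E.
by move: (chebU n) => u; ring.
Qed.

Lemma derivn_cheb j m :
  (cheb R (m + j.+1))^`(j.+1) = (m + j).+1%:R * geg j m.
Proof. by rewrite addnS derivSn deriv_cheb derivn_natM. Qed.

Lemma tau_at_cheb j m w : tau_at (m + j.+1) j.+1 w = rel_value j m w.
Proof.
rewrite /tau_at /rel_value derivn_cheb !horner_natM normrM normr_nat.
by rewrite -mulf_div divff ?mul1r // pnatr_eq0.
Qed.

Lemma rightmost_root_cheb j m w :
  rightmost_root (cheb R (m.+1 + j.+1))^`(j.+2) w <->
  rightmost_root (geg j.+1 m) w.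
Proof.
rewrite derivnS derivn_cheb deriv_natM deriv_geg.
rewrite /rightmost_root /root horner_natM mulf_eq0 pnatr_eq0 /=.
by split=> -[h1 h2]; split=> // x; have := h2 x;
  rewrite /root horner_natM mulf_eq0 pnatr_eq0.
Qed.

Lemma tau_eq_toproot j m w : toproot j.+1 m w ->
  tau_eq (m.+2 + j.+1) j.+1 (rel_value j m.+2 w).
Proof.
move=> tw; exists w; last exact: tau_at_cheb.
by apply/rightmost_root_cheb; exact: toproot_rightmost.
Qed.

Lemma tau_le_toproot j m n w : toproot j.+1 m w -> (m.+2 + j.+1 <= n)%N ->
  tau_le n j.+1 (rel_value j m.+2 w).
Proof.
move=> tw le_n w'.
have -> : n = ((n - j.+3).+2 + j.+1)%N by lia.
move=> /rightmost_root_cheb rw'; rewrite tau_at_cheb.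
have [v tv] := toproot_ex j.+1 (n - j.+3).
rewrite (rightmost_root_inj rw' (toproot_rightmost tv)).
apply: (rel_value_le_from _ tw tv).
by lia.
Qed.

(** * Explicit low degrees and the three values *)

Lemma horner_geg2 j x :
  (geg j 2).[x] = j.+1%:R * (geg j 0).[x] * (2 * j.+2%:R * x ^+ 2 - 1).
Proof.
have /mulfI : 2%:R != 0 :> R by rewrite pnatr_eq0.
apply; rewrite horner_geg_rec horner_geg1 -muln2; ring.
Qed.

Lemma horner_geg3 j x : (geg j 3).[x] =
  2 / 3 * (j.+1%:R * j.+2%:R * (geg j 0).[x]) * (x * (2 * j.+3%:R * x ^+ 2 - 3)).
Proof.
have /mulfI : 3%:R != 0 :> R by rewrite pnatr_eq0.
apply; rewrite horner_geg_rec horner_geg1 horner_geg2 -muln2; by field.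
Qed.

Lemma horner_geg4 j x : (geg j 4).[x] =
  6^-1 * (j.+1%:R * j.+2%:R * (geg j 0).[x]) *
  (4 * j.+3%:R * j.+4%:R * x ^+ 4 - 12 * j.+3%:R * x ^+ 2 + 3).
Proof.
have /mulfI : 4%:R != 0 :> R by rewrite pnatr_eq0.
apply; rewrite horner_geg_rec horner_geg3 horner_geg2 -muln2; by field.
Qed.

Lemma geg0_gt0 j x : 0 < (geg j 0).[x].
Proof. by have [c c0 ->] := geg0_const j; rewrite hornerC. Qed.

Lemma horner_geg0 j x : (geg j 0).[x] = (geg j 0).[1].
Proof. by have [c _ ->] := geg0_const j; rewrite !hornerC. Qed.

Lemma normr_div_pM (d u v : R) : 0 < d -> `|d * u| / (d * v) = `|u| / v.
Proof.
move=> d0; rewrite normrM gtr0_norm // -mulf_div divff ?mul1r //.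
exact: lt0r_neq0.
Qed.

Lemma rel_value2 j w : toproot j.+1 0 w ->
  rel_value j 2 w = (2 * j.+1 + 1)%:R^-1.
Proof.
move/toproot_rightmost/(rightmost_root_inj (toproot_rightmost (toproot0 _))) <-.
rewrite /rel_value !horner_geg2 horner_geg0 normr_div_pM; last first.
  by rewrite mulr_gt0 ?ltr0n ?geg0_gt0.
rewrite expr0n mulr0 sub0r normrN1 div1r; congr (_^-1); ring.
Qed.

Lemma rel_value3 j w : toproot j.+1 1 w ->
  rel_value j 3 w = (2 * j.+1 + 1)%:R^-1 * Num.sqrt (2 / (j.+1 + 2)%:R).
Proof.
move=> [_ w0 pos _].
(* [geg _ 1] is a positive multiple of x, so its positivity at [w] selects the positive root. *)
have {}pos : 0 < w.
  have := pos 1%N isT; rewrite horner_geg1 pmulr_lgt0 ?geg0_gt0 //.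
  by rewrite pmulr_rgt0 ?ltr0n.
have /eqP := w0; rewrite horner_geg2 mulf_eq0 subr_eq0.
rewrite gt_eqF ?mulr_gt0 ?ltr0n ?geg0_gt0 //= => /eqP w2.
(* The zero satisfies 2(j+3)w^2 = 1, that is (2w)^2 = 2/(j+3). *)
have -> : Num.sqrt (2 / (j.+1 + 2)%:R) = 2 * w.
  rewrite -[RHS]gtr0_norm ?mulr_gt0 // -sqrtr_sqr; congr Num.sqrt.
  have -> : (j.+1 + 2)%:R = j.+3%:R :> R by rewrite addn2.
  apply: (@mulIf _ j.+3%:R); rewrite ?pnatr_eq0 // divfK ?pnatr_eq0 //.
  transitivity (2 * (2 * j.+3%:R * w ^+ 2)); last by ring.
  by rewrite w2 mulr1.
rewrite /rel_value !horner_geg3 horner_geg0 normr_div_pM; last first.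
  by rewrite !mulr_gt0 ?invr_gt0 ?ltr0n ?geg0_gt0.
rewrite w2 mulrC; congr (_^-1 * _); first by ring.
have -> : w * (1 - 3) = - (2 * w) by ring.
by rewrite normrN gtr0_norm // mulr_gt0.
Qed.

Lemma rel_value4 j w : toproot j.+1 2 w ->
  rel_value j 4 w = (2 * j.+1 + 1)%:R^-1 * (3 / (j.+1 + 3)%:R).
Proof.
move=> [_ w0 pos _].
have {}pos : 0 < w.
  have := pos 1%N isT; rewrite horner_geg1 pmulr_lgt0 ?geg0_gt0 //.
  by rewrite pmulr_rgt0 ?ltr0n.
have /eqP := w0; rewrite horner_geg3 mulf_eq0 gt_eqF /=; last first.
  by rewrite !mulr_gt0 ?invr_gt0 ?ltr0n ?geg0_gt0.
rewrite mulf_eq0 gt_eqF //= subr_eq0 => /eqP w2.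
have j4 : j.+4%:R != 0 :> R by rewrite pnatr_eq0.
have {}w2 : w ^+ 2 = 3 / (2 * j.+4%:R).
  by rewrite -w2 mulrAC divff ?mul1r // mulf_neq0 // pnatr_eq0.
rewrite /rel_value !horner_geg4 horner_geg0 normr_div_pM; last first.
  by rewrite !mulr_gt0 ?ltr0n ?geg0_gt0 ?invr_gt0.
rewrite (exprM w 2 2) w2.
(* The values at [w] and at 1 share the factor 2j+5, which cancels in the quotient. *)
have -> : 4 * j.+3%:R * j.+4%:R * (3 / (2 * j.+4%:R)) ^+ 2
  - 12 * j.+3%:R * (3 / (2 * j.+4%:R)) + 3 = - (3 * (2 * j + 5)%:R / j.+4%:R) :> R.
  by field; rewrite -?natrD pnatr_eq0.
rewrite normrN ger0_norm ?divr_ge0 ?mulr_ge0 ?ler0n //.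
have -> : 4 * j.+3%:R * j.+4%:R * 1 ^+ 4 - 12 * j.+3%:R * 1 ^+ 2 + 3 =
  (2 * j + 3)%:R * (2 * j + 5)%:R :> R by ring.
have -> : (2 * j.+1 + 1 = 2 * j + 3)%N by lia.
have -> : (j.+1 + 3 = j.+4)%N by lia.
by field; rewrite -natrM -!natrD !pnatr_eq0 !addnS.
Qed.
End Gegenbauer.

Theorem theorem1p2 (R : realType) (k : nat) (hk : (1 <= k)%N) :
  let c : R := ((2 * k + 1)%:R)^-1 in
  tau_eq (k + 2) k c /\
      tau_eq (k + 3) k (c * Num.sqrt (2 / (k + 2)%:R)) /\
      tau_eq (k + 4) k (c * (3 / (k + 3)%:R)) /\
      (forall n : nat, (k + 2 <= n)%N -> tau_le n k c) /\
      (forall n : nat, (k + 3 <= n)%N -> tau_le n k (c * Num.sqrt (2 / (k + 2)%:R))) /\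
      (forall n : nat, (k + 4 <= n)%N -> tau_le n k (c * (3 / (k + 3)%:R))).
Proof.
case: k hk => // j _ c.
have [w0 t0] := toproot_ex R j.+1 0.
have [w1 t1] := toproot_ex R j.+1 1.
have [w2 t2] := toproot_ex R j.+1 2.
(* The two longer constants are folded first, since the value of [c] occurs inside them. *)
rewrite /c -(rel_value3 t1) -(rel_value4 t2) -(rel_value2 t0) ![(j.+1 + _)%N]addnC.
split; first exact: tau_eq_toproot.
split; first exact: tau_eq_toproot.
split; first exact: tau_eq_toproot.
by do !split; move=> n; exact: tau_le_toproot.
Qed.
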